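(* Let $G$ be a torsion abelian group. Then $\widetilde{ns}(G)=0$ if and only if $r_p(G)$ is finite for every prime $p$.
   Context: $\mathbb N=\{0,1,2,\dots\}$ and $\mathbb N_+=\mathbb N\setminus\{0\}$. Let $\phi$ be an endomorphism of an abelian group $G$. A string of $\phi$ is a sequence $S=\{x_n\}_{n\in\mathbb N}$ of pairwise distinct elements of $G$ such that $\phi(x_n)=x_{n-1}$ for every $n\in\mathbb N_+$. A string is singular if $\phi^j(x_0)=\phi^k(x_0)$ for some $j\neq k$ in $\mathbb N$, and non-singular otherwise. Define $ns(\phi)$ as the supremum of the cardinalities $|\mathcal F|$, where $\mathcal F$ ranges over the families of pairwise disjoint non-singular strings of $\phi$; if this supremum is infinite it is set equal to the symbol $\infty$. For an abelian group $G$, $ns(G)=\sup\{ns(\phi):\phi\in\mathrm{End}(G)\}$ and $\widetilde{ns}(G)=\sup\{ns(H):H\leq G\}$, where $H$ ranges over all subgroups of $G$. For a prime $p$, $r_p(G)=\dim_{\mathbb F_p}G[p]$ is the $p$-rank of $G$, where $G[p]=\{x\in G:px=0\}$. *)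

(* Defs.v *)
From HB Require Import structures.
From mathcomp Require Import all_boot all_order all_algebra.
From mathcomp Require Import finmap mathcomp_extra boolp classical_sets functions.
From mathcomp Require Import cardinality constructive_ereal.

Set Implicit Arguments.
Unset Strict Implicit.
Unset Printing Implicit Defensive.

Import Order.TTheory GRing.Theory Num.Theory.
Local Open Scope classical_set_scope.
Local Open Scope ring_scope.

(* Values in {0, 1, 2, ...} together with oo are taken in \bar int: it is a
   complete linear order, so [supremum] is the actual least upper bound of any
   nonempty subset, and all infinite cardinalities are identified with +oo. *)
Definition ecard (T : choiceType) (A : set T) : \bar int :=
  if `[< finite_set A >] then ((#|` fset_set A|)%:Z)%:E%E else +oo%E.

(* zmodClosed ranges over boolean predicates; under the classical axioms of
   boolp these are all the subgroups of G. *)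
Section Subgroup.
Variables (G : zmodType) (H : zmodClosed G).

Record subgroup_type := SubgroupElt {
  subgroup_val :> G;
  subgroup_valP : subgroup_val \in H
}.

HB.instance Definition _ := [isSub for subgroup_val].
HB.instance Definition _ := [Choice of subgroup_type by <:].
HB.instance Definition _ := [SubChoice_isSubZmodule of subgroup_type by <:].
End Subgroup.

Section Strings.
Variable G : zmodType.

Definition is_string (phi : G -> G) (x : nat -> G) :=
  injective x /\ forall n, phi (x n.+1) = x n.

Definition singular (phi : G -> G) (x : nat -> G) :=
  exists j k : nat, j <> k /\ iter j phi (x 0%N) = iter k phi (x 0%N).

Definition disjoint_ns_family (phi : G -> G) (F : set (nat -> G)) :=
  (forall x, F x -> is_string phi x /\ ~ singular phi x) /\
  trivIset F (fun x => range x).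

Definition ns_endo (phi : {additive G -> G}) : \bar int :=
  supremum 0%E [set ecard F | F in disjoint_ns_family phi].

Definition ns : \bar int :=
  supremum 0%E [set ns_endo phi | phi in [set: {additive G -> G}]].
End Strings.

Definition ns_tilde (G : zmodType) : \bar int :=
  supremum 0%E [set ns (subgroup_type H) | H in [set: zmodClosed G]].

Section Dimension.
Variables (K : fieldType) (V : lmodType K).

Definition lin_independent (B : set V) :=
  forall (s : seq V) (c : V -> K), uniq s -> (forall x, x \in s -> B x) ->
    \sum_(x <- s) c x *: x = 0 -> forall x, x \in s -> c x = 0.

Definition spanning (B : set V) :=
  forall v : V, exists (s : seq V) (c : V -> K),
    (forall x, x \in s -> B x) /\ v = \sum_(x <- s) c x *: x.

(* The cardinality of some (equivalently, any) Hamel basis; the default value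
   of xget is immaterial since a basis always exists. *)
Definition dimension : \bar int :=
  xget +oo%E [set ecard B | B in lin_independent `&` spanning].
End Dimension.

Section PTorsion.
Variable G : zmodType.

Definition is_torsion := forall x : G, exists n : nat, (0 < n)%N /\ x *+ n = 0.

Section Prime.
Variable p : nat.

Definition ptorsion : {pred G} := [pred x : G | x *+ p == 0].

Fact ptorsion_closed : zmod_closed ptorsion.
Proof.
split=> [|x y]; rewrite !inE ?mul0rn// => /eqP xp /eqP yp.
by rewrite mulrnBl xp yp subrr.
Qed.

HB.instance Definition _ := GRing.isZmodClosed.Build G ptorsion ptorsion_closed.

Hypothesis p_pr : prime p.

(* G[p]; the primality proof is an argument of the type so that the canonical
   scaling by 'F_p below can depend on it. *)
Definition ptorsion_space of prime p := subgroup_type ptorsion.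

HB.instance Definition _ :=
  GRing.Zmodule.copy (ptorsion_space p_pr) (subgroup_type ptorsion).

Definition ptorsion_scale (a : 'F_p) (x : ptorsion_space p_pr) :
  ptorsion_space p_pr := x *+ (a : nat).

Fact ptorsion_mulrn_mod (x : ptorsion_space p_pr) n :
  x *+ (n %% (Zp_trunc (pdiv p)).+2) = x *+ n.
Proof.
rewrite Fp_cast//.
have xp0 : x *+ p = 0.
  apply: val_inj; rewrite (raddfMn (val : subgroup_type ptorsion -> G)).
  by rewrite raddf0; apply/eqP; exact: valP x.
by rewrite {2}(divn_eq n p) mulrnDr mulnC mulrnA xp0 mul0rn add0r.
Qed.

Fact ptorsion_scaleA a b x :
  ptorsion_scale a (ptorsion_scale b x) = ptorsion_scale (a * b) x.
Proof.
by rewrite /ptorsion_scale /= ptorsion_mulrn_mod mulnC mulrnA.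
Qed.

Fact ptorsion_scale1 : left_id 1 ptorsion_scale.
Proof. by move=> x; rewrite /ptorsion_scale /= ?modn_small. Qed.

Fact ptorsion_scaleDr : right_distributive ptorsion_scale +%R.
Proof. by move=> a x y; rewrite /ptorsion_scale mulrnDl. Qed.

Fact ptorsion_scaleDl x : {morph ptorsion_scale^~ x : a b / a + b}.
Proof.
by move=> a b; rewrite /ptorsion_scale /= ptorsion_mulrn_mod mulrnDr.
Qed.

HB.instance Definition _ := GRing.Zmodule_isLmodule.Build 'F_p
  (ptorsion_space p_pr) ptorsion_scaleA ptorsion_scale1 ptorsion_scaleDr
  ptorsion_scaleDl.

Definition p_rank : \bar int := dimension (ptorsion_space p_pr : lmodType 'F_p).
End Prime.
End PTorsion.

Arguments p_rank G [p] p_pr.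

(* Main.v *)
Require Import Defs.
From mathcomp Require Import all_boot all_order all_algebra.
From mathcomp Require Import constructive_ereal.
From HB Require Import structures.
From mathcomp Require Import finmap boolp classical_sets functions cardinality.

Set Implicit Arguments.
Unset Strict Implicit.
Unset Printing Implicit Defensive.

Import Order.TTheory GRing.Theory Num.Theory.
Local Open Scope classical_set_scope.
Local Open Scope ring_scope.

(** If all p-ranks are finite then so is every n-torsion part of G, hence of
    every subgroup H.  An endomorphism of H maps the n-torsion of H to itself,
    so each of its orbits is finite and, by pigeonhole, each of its strings is
    singular: every supremum is taken over the single value 0
    ([finite_torsion_singular], [finite_ntorsion]).

    Conversely, if r_p(G) is infinite then the socle G[p] has an infinite
    basis (a basis exists by Zorn, [dimension_basis]), hence an independent
    sequence, i.e. an embedding into G of a vector space with a countable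
    basis; {poly 'F_p} with its monomials is the model used here.  Split the
    monomials into two rays, even exponents and odd exponents, to index the
    basis by the integers: the bilateral shift along this indexing has the
    even ray as a non-singular string, since the orbit of its first term goes on
    along the odd ray.  Transporting the shift to the image of the embedding
    ([ns_tilde_ge1]) yields a subgroup H of G with ns(H) >= 1.

    The lower bound has to survive three nested suprema, which is possible
    because sets of extended integers with a nonnegative element have a least
    upper bound ([supremums_eint]). *)

(** * Suprema of extended integers *)

(** Some nonnegative element forces every upper bound to be a natural number
    or +oo, so the well-ordering of the natural numbers provides the least one. *)
Lemma supremums_eint (A : set (\bar int)) (a : \bar int) :
  A a -> (0 <= a)%E -> supremums A !=set0.
Proof.
move=> Aa a0.
have ub_nat y : ubound A y -> y = +oo%E \/ exists n : nat, y = (n%:Z)%:E%E.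
  move=> /(_ a Aa) /(le_trans a0).
  by case: y => [[n|n]|//|] // _; [right; exists n|left].
have [[n ubn]|noub] := pselect (exists n : nat, ubound A (n%:Z)%:E%E).
  have exn : exists m : nat, `[< ubound A (m%:Z)%:E%E >].
    by exists n; apply/asboolP.
  case: (ex_minnP exn) => m /asboolP ubm minm.
  exists (m%:Z)%:E%E; split=> // y uby.
  have [->|[k yk]] := ub_nat _ uby; first exact: leey.
  by rewrite yk lee_fin lez_nat; apply/minm/asboolP; rewrite -yk.
exists +oo%E; split=> [y _|y uby]; first exact: leey.
by have [->//|[k yk]] := ub_nat _ uby; case: noub; exists k; rewrite -yk.
Qed.

Lemma le_supremum_eint (A : set (\bar int)) (a : \bar int) :
  A a -> (0 <= a)%E -> (a <= supremum 0%E A)%E.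
Proof.
by move=> Aa a0; exact: ge_supremum_Nmem (supremums_eint Aa a0) Aa.
Qed.

Lemma supremum_const (T : Type) (A : set T) (f : T -> \bar int) :
  (exists x, A x) -> (forall x, A x -> f x = 0%E) ->
  supremum 0%E [set f x | x in A] = 0%E.
Proof.
move=> [x Ax] f0; rewrite (_ : [set _ | _ in _] = [set 0%E]) ?supremum1 //.
by apply/seteqP; split=> [_ [y Ay <-]|_ ->]; [exact: f0|exists x => //; exact: f0].
Qed.

(** * Strings and the invariants ns *)

(** A single non-singular string already forms a disjoint family. *)
Lemma ns_ge1 (G : zmodType) (phi : {additive G -> G}) (x : nat -> G) :
  is_string phi x -> ~ singular phi x -> (1%:E <= ns G)%E.
Proof.
move=> str nsx.
have h1 : (1%:E <= ns_endo phi)%E.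
  apply: le_supremum_eint => //; exists [set x].
    split; last exact: trivIset1.
    by move=> y ->.
  rewrite /ecard ifT; last by apply/asboolP; exact: finite_set1.
  by rewrite fset_set1 cardfs1.
apply: (le_trans h1); apply: le_supremum_eint; first by exists phi.
exact: le_trans h1.
Qed.

(** The empty family is then the only one, and it is always admissible. *)
Lemma ns_eq0 (G : zmodType) :
  (forall (phi : {additive G -> G}) x, is_string phi x -> singular phi x) ->
  ns G = 0%E.
Proof.
move=> sing; apply: supremum_const; first by exists (idfun : {additive G -> G}).
move=> phi _; apply: supremum_const.
  by exists set0; split=> [x []|x y []].
move=> F [nsF _]; suff -> : F = set0.
  rewrite /ecard ifT; last by apply/asboolP; exact: finite_set0.
  by rewrite fset_set0 cardfs0.
by apply/seteqP; split=> // x /nsF [/sing].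
Qed.

(** * Transport of an endomorphism to the image of an embedding *)

(** The subgroup f(W) of G is a copy of W as soon as f is injective, so that
    strings in W become strings in a subgroup of G. *)
Section Image.
Variables (W G : zmodType) (f : {additive W -> G}).

Definition image_pred : {pred G} := fun x => `[< exists w, f w = x >].

Fact image_pred_closed : zmod_closed image_pred.
Proof.
split=> [|x y]; first by apply/asboolP; exists 0; rewrite raddf0.
move=> /asboolP[v <-] /asboolP[w <-]; apply/asboolP.
by exists (v - w); rewrite raddfB.
Qed.

HB.instance Definition _ := GRing.isZmodClosed.Build G image_pred image_pred_closed.

Notation H := (subgroup_type image_pred).

Fact mem_image_pred w : f w \in image_pred.
Proof. by apply/asboolP; exists w. Qed.

Definition to_image (w : W) : H := SubgroupElt (mem_image_pred w).

Fact image_preimage (u : H) : exists w, f w = val u.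
Proof. exact/asboolP/(valP u). Qed.

Definition of_image (u : H) : W := projT1 (cid (image_preimage u)).

Lemma of_imageK : cancel of_image to_image.
Proof. by move=> u; apply: val_inj => /=; rewrite /of_image; case: cid. Qed.

Hypothesis f_inj : injective f.

Lemma to_imageK : cancel to_image of_image.
Proof. by move=> w; apply: f_inj; rewrite /of_image; case: cid. Qed.

Variable psi : {additive W -> W}.

Definition image_endo (u : H) : H := to_image (psi (of_image u)).

Fact image_endo_zmod_morphism : zmod_morphism image_endo.
Proof.
have of_imageB : zmod_morphism of_image.
  move=> u v; apply: f_inj; rewrite raddfB.
  have fE w : f (of_image w) = val w by rewrite /of_image; case: cid.
  by rewrite !fE.
move=> u v; apply: val_inj; rewrite /= of_imageB !raddfB //.
Qed.

HB.instance Definition _ := GRing.isZmodMorphism.Build H H image_endo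
  image_endo_zmod_morphism.

Lemma ns_tilde_ge1 (x : nat -> W) :
  is_string psi x -> ~ singular psi x -> (1%:E <= ns_tilde G)%E.
Proof.
move=> [x_inj x_psi] nsx.
have ns1 : (1%:E <= ns H)%E.
  apply: (@ns_ge1 _ image_endo (to_image \o x)).
    split; first exact: inj_comp (can_inj to_imageK) x_inj.
    by move=> n /=; rewrite /image_endo to_imageK x_psi.
  have itE n : iter n image_endo (to_image (x 0%N)) = to_image (iter n psi (x 0%N)).
    by elim: n => //= n ->; rewrite /image_endo to_imageK.
  move=> [j [k [jk]]]; rewrite /= !itE => /(can_inj to_imageK) E.
  by apply: nsx; exists j, k.
apply: (le_trans ns1); apply: le_supremum_eint; first by exists (image_pred : zmodClosed G).
exact: le_trans ns1.
Qed.

End Image.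

(** * Bases *)

Section Bases.
Variables (K : fieldType) (V : lmodType K).

(** Any finite list drawn from the union of a chain lies in one member of it,
    which is how independence passes to the union, as Zorn's lemma requires. *)
Lemma lin_independent_chain (F : set (set V)) :
  F `<=` lin_independent (V := V) -> total_on F subset ->
  lin_independent (\bigcup_(X in F) X).
Proof.
move=> Find Ftot [|y s] c us sF s0 // x xs.
suff [X FX sX] : exists2 X, F X & forall z, z \in y :: s -> X z.
  exact: (Find X FX (y :: s) c).
move: sF; elim: (y :: s) (isT : y :: s != [::]) => // {us s0 xs x}z [|z' t] IH _ sF.
  by have [X FX Xz] := sF z (mem_head _ _); exists X => // w; rewrite inE => /eqP->.
have [||X FX tX] := IH; [by []|by move=> w wt; apply: sF; rewrite inE wt orbT|].
have [Y FY Yz] := sF z (mem_head _ _).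
have [XY|YX] := Ftot _ _ FX FY.
  by exists Y => // w; rewrite inE => /orP[/eqP->//|/tX/XY].
by exists X => // w; rewrite inE => /orP[/eqP->|/tX//]; exact: YX.
Qed.

(** A vector v outside B creates a dependence relation in B + {v}; its
    coefficient at v is nonzero because B is independent, so v can be solved
    for. *)
Lemma max_lin_independent_spanning (B : set V) :
  lin_independent B -> (forall C, B `<` C -> ~ lin_independent C) -> spanning B.
Proof.
move=> Bind Bmax v.
have [Bv|nBv] := pselect (B v).
  exists [:: v], (fun=> 1); split; last by rewrite big_seq1 scale1r.
  by move=> x; rewrite inE => /eqP->.
have /Bmax/existsNP[s /existsNP[c]] : B `<` (B `|` [set v]).
  split; last by move=> /(_ v); apply: contra_not nBv; apply; right.
  by move=> x; left.
move=> /not_implyP[us] /not_implyP[sBv] /not_implyP[s0].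
move=> /existsNP[x] /not_implyP[xs cx].
have remB y : y \in rem v s -> B y.
  by rewrite mem_rem_uniq // inE => /andP[/= yv /sBv[//|yv']]; rewrite yv' eqxx in yv.
have [vs|nvs] := boolP (v \in s); last first.
  case: cx; apply: (Bind s c us _ s0 x xs) => y ys.
  by apply: remB; rewrite rem_id.
move: s0; rewrite (big_rem v vs) /= => s0.
have cv : c v != 0.
  apply/eqP => cv0; apply: cx; have [->//|xv] := eqVneq x v.
  move: s0; rewrite cv0 scale0r add0r => s0.
  apply: (Bind (rem v s) c (rem_uniq _ us) remB s0).
  by rewrite mem_rem_uniq // inE /= xv.
exists (rem v s), (fun y => - (c v)^-1 * c y); split=> //.
apply: (scalerI cv); rewrite scaler_sumr.
move/eqP: s0; rewrite addr_eq0 => /eqP ->; rewrite -sumrN; apply: eq_bigr => y _.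
by rewrite scalerA mulrA mulrN divff // mulN1r scaleNr.
Qed.

(** The value of [dimension] is that of some unspecified basis: the default
    value is excluded by the existence of a maximal independent set. *)
Lemma dimension_basis :
  exists2 B : set V, lin_independent B /\ spanning B & dimension V = ecard B.
Proof.
have [B [Bind Bmax]] := Zorn_bigcup lin_independent_chain.
have Bspan := max_lin_independent_spanning Bind Bmax.
have [C [Cind Cspan] <-] : [set ecard B | B in lin_independent (V := V) `&` spanning (V := V)]
    (dimension V).
  by apply: xgetPex; exists (ecard B), B.
by exists C.
Qed.

End Bases.

Lemma finite_spanning (K : finFieldType) (V : lmodType K) (B : set V) :
  finite_set B -> spanning B -> finite_set [set: V].
Proof.
move=> /finite_seqP[b ->] Bspan.
pose comb (g : {ffun 'I_(size b) -> K}) := \sum_i g i *: b`_i.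
apply: (@sub_finite_set _ _ (range comb)); last exact/finite_image/finite_finset.
move=> v _; have [s [c [sb ->]]] := Bspan v.
elim: s sb => [_|x s IH sb]; rewrite ?big_nil ?big_cons.
  by exists [ffun=> 0] => //; rewrite /comb big1 // => i _; rewrite ffunE scale0r.
have [y ys|g _ gE] := IH; first by apply: sb; rewrite inE ys orbT.
have xb : (index x b < size b)%N by rewrite index_mem; apply: sb; exact: mem_head.
(* Lists drawn from B may repeat elements, so coefficients accumulate. *)
exists [ffun i => (if i == Ordinal xb then c x else 0) + g i] => //.
rewrite -gE /comb; under eq_bigr do rewrite ffunE scalerDl.
rewrite big_split /= (bigD1 (Ordinal xb)) //= eqxx nth_index -?index_mem //.
by rewrite big1 ?addr0 // => i /negPf ->; rewrite scale0r.
Qed.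

(** * Linear combinations along a sequence *)

Section Lincomb.
Variables (K : fieldType) (V : lmodType K) (e : nat -> V).

(** The linear map from {poly K} that sends the monomial of degree i to e i. *)
Definition lincomb (p : {poly K}) : V := \sum_(i < size p) p`_i *: e i.

Lemma lincomb_widen n (p : {poly K}) : (size p <= n)%N -> lincomb p = \sum_(i < n) p`_i *: e i.
Proof.
move=> pn; rewrite /lincomb (big_ord_widen n (fun i => p`_i *: e i)) //.
rewrite big_mkcond; apply: eq_bigr => i _; case: ltnP => // pi.
by rewrite nth_default // scale0r.
Qed.

Fact lincomb_zmod_morphism : zmod_morphism lincomb.
Proof.
move=> p q; pose n := maxn (size p) (size q).
have pq : (size (p - q)%R <= n)%N.
  by rewrite (leq_trans (size_polyD _ _)) // size_polyN.
rewrite (lincomb_widen pq) (@lincomb_widen n p) ?leq_maxl //.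
rewrite (@lincomb_widen n q) ?leq_maxr // -sumrB; apply: eq_bigr => i _.
by rewrite coefB scalerBl.
Qed.

HB.instance Definition _ := GRing.isZmodMorphism.Build {poly K} V lincomb
  lincomb_zmod_morphism.

Lemma lincombXn n : lincomb 'X^n = e n.
Proof.
rewrite (@lincomb_widen n.+1) ?size_polyXn // big_ord_recr /= coefXn eqxx scale1r.
by rewrite big1 ?add0r // => i _; rewrite coefXn (ltn_eqF (ltn_ord i)) scale0r.
Qed.

Lemma lincomb_inj : injective e -> lin_independent (range e) -> injective lincomb.
Proof.
move=> e_inj e_ind; apply: raddf_inj => p p0.
(* Independence is phrased with coefficients indexed by vectors, so those of
   p have to be read through the inverse of e. *)
pose idx x := xget 0%N [set n | e n = x].
have idxK : cancel e idx.
  by move=> n; apply/e_inj/(@xgetPex _ 0%N [set m | e m = e n]); exists n.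
apply/polyP=> i; rewrite coef0.
have [ip|pi] := ltnP i (size p); last exact: nth_default.
rewrite -(idxK i).
apply: (e_ind [seq e j | j <- iota 0 (size p)] (fun x => p`_(idx x))).
- by rewrite (map_inj_uniq e_inj) iota_uniq.
- by move=> _ /mapP[j _ ->]; exists j.
- rewrite big_map; move: p0; rewrite /= /lincomb.
  rewrite -(big_mkord xpredT (fun j => p`_j *: e j)) /index_iota subn0 => {2}<-.
  by apply: eq_bigr => j _; rewrite idxK.
- by rewrite (mem_map e_inj) mem_iota.
Qed.

End Lincomb.

(** * The bilateral shift *)

(** The bilateral shift, with the integers laid out on the natural numbers:
    ... -> 4 -> 2 -> 0 -> 1 -> 3 -> 5 -> ... *)
Definition shift_index (n : nat) : nat :=
  if n is 0 then 1%N else if odd n then n.+2 else n.-2.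

(** The orbit of the monomial of degree 0 runs through the odd degrees and never
    comes back, which makes the even ray non-singular. *)
Lemma iter_shift (K : fieldType) n :
  iter n (lincomb (fun i => 'X^(shift_index i) : {poly K})) 'X^0 =
  'X^(if n is m.+1 then m.*2.+1 else 0%N).
Proof.
elim: n => // n IH; rewrite iterS IH lincombXn; case: n {IH} => //= n.
by rewrite odd_double.
Qed.

(** An infinite independent set contains an injective sequence, along which
    {poly K} and its bilateral shift embed into G. *)
Lemma infinite_basis_ns_tilde (K : fieldType) (V : lmodType K) (G : zmodType)
    (f : {additive V -> G}) (B : set V) :
  injective f -> lin_independent B -> infinite_set B -> (1%:E <= ns_tilde G)%E.
Proof.
move=> f_inj Bind /infiniteP/card_leP[h].
pose e n := val (h (SigSub (mem_setT n))) : V.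
have e_inj : injective e by move=> m n /val_inj /(in2TT 'inj_h) [].
have e_ind : lin_independent (range e).
  move=> s c us se; apply: Bind => // x /se [n _ <-].
  exact/set_mem/(valP (h _)).
have X_inj : injective (fun n => 'X^n : {poly K}).
  by move=> m n /(congr1 (fun p : {poly K} => size p)); rewrite !size_polyXn => -[].
pose g : {additive {poly K} -> G} := f \o lincomb e.
apply: (@ns_tilde_ge1 _ _ g _ (lincomb (fun i => 'X^(shift_index i) : {poly K}))
  (fun n => 'X^(n.*2))).
- exact: inj_comp f_inj (lincomb_inj e_inj e_ind).
- split=> [m n /X_inj /double_inj //|n].
  by rewrite [LHS](lincombXn _ n.+1.*2) /= odd_double.
- move=> [j [k [jk]]]; rewrite !iter_shift => /X_inj.
  by case: j k jk => [|j] [|k] //= jk [] /double_inj jk'; rewrite jk' in jk.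
Qed.

(** * Finiteness of torsion *)

(** For a prime p dividing n, multiplication by p maps the n-torsion to the
    (n/p)-torsion, and each fibre is empty or a coset of the p-torsion. *)
Lemma finite_ntorsion (G : zmodType) :
  (forall p, prime p -> finite_set [set x : G | x *+ p = 0]) ->
  forall n, (0 < n)%N -> finite_set [set x : G | x *+ n = 0].
Proof.
move=> finp; elim/ltn_ind => n IH n0.
have [n1|n1] := leqP n 1.
  have -> : n = 1%N by apply/eqP; rewrite eqn_leq n1 n0.
  by apply: sub_finite_set (finite_set1 0) => x.
have p_pr := pdiv_prime n1; set p := pdiv n in p_pr.
have nE : n = (p * (n %/ p))%N by rewrite mulnC divnK // pdiv_dvd.
have m0 : (0 < n %/ p)%N by rewrite divn_gt0 ?prime_gt0 // pdiv_leq.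
have mn : (n %/ p < n)%N by rewrite ltn_Pdiv // prime_gt1.
apply: (@sub_finite_set _ _ (\bigcup_(y in [set y : G | y *+ (n %/ p) = 0])
                               [set x | x *+ p = y])).
  by move=> x /= xn; exists (x *+ p) => //=; rewrite -mulrnA -nE.
apply: bigcup_finite; first exact: IH.
move=> y _; have [[x0 x0y]|no] := pselect (exists x0 : G, x0 *+ p = y); last first.
  by apply: sub_finite_set (finite_set0 G) => x /= xy; case: no; exists x.
apply: sub_finite_set (finite_image (fun z => z + x0) (finp p p_pr)) => x /= xy.
by exists (x - x0); rewrite /= ?subrK // mulrnBl xy x0y subrr.
Qed.

Lemma finite_p_rank_ptorsion (G : zmodType) p (p_pr : prime p) :
  (p_rank G p_pr < +oo)%E -> finite_set [set x : G | x *+ p = 0].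
Proof.
have [B [_ Bspan] rE] := dimension_basis (ptorsion_space G p_pr : lmodType 'F_p).
rewrite /p_rank rE /ecard; case: asboolP => // Bfin _.
have Vfin := finite_spanning Bfin Bspan.
apply: sub_finite_set (finite_image (val : subgroup_type (ptorsion p) -> G) Vfin).
move=> x /= /eqP xp; have xP : x \in (ptorsion p : {pred G}) by rewrite inE.
by exists (SubgroupElt xP).
Qed.

(** The orbit of x 0 stays in the torsion of a fixed order, which is finite, so
    two of its terms coincide. *)
Lemma finite_torsion_singular (G : zmodType) (phi : {additive G -> G}) x :
  is_torsion G -> (forall n, (0 < n)%N -> finite_set [set y : G | y *+ n = 0]) ->
  singular phi x.
Proof.
move=> tG finG; apply: contrapT => nsx.
have [n [n0 xn]] := tG (x 0%N).
have orbn j : iter j phi (x 0%N) *+ n = 0.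
  by elim: j => //= j IH; rewrite -raddfMn IH raddf0.
apply: infinite_nat.
apply: sub_finite_set (@finite_preimage _ _ _ (fun j => iter j phi (x 0%N)) _ (finG n n0)).
  by move=> j _; exact: orbn.
move=> j k _ _ jk; apply: contrapT => njk.
by apply: nsx; exists j, k.
Qed.

Theorem lemma7p3 (G : zmodType) (tG : is_torsion G) :
  ns_tilde G = 0%E <->
  (forall (p : nat) (p_pr : prime p), (p_rank G p_pr < +oo)%E).
Proof.
split=> [ns0 p p_pr|rfin].
  have [B [Bind _] rE] := dimension_basis (ptorsion_space G p_pr : lmodType 'F_p).
  rewrite /p_rank rE /ecard; case: asboolP => [_|Binf]; first exact: ltry.
  suff : (1%:E <= ns_tilde G)%E by rewrite ns0.
  pose f : {additive subgroup_type (@ptorsion G p) -> G} := val.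
  pose V : lmodType 'F_p := ptorsion_space G p_pr.
  exact: (@infinite_basis_ns_tilde _ V G f _ val_inj Bind Binf).
have fin := finite_ntorsion (fun p p_pr => finite_p_rank_ptorsion (rfin p p_pr)).
apply: supremum_const; first by exists (@ptorsion G 0 : zmodClosed G).
move=> H _; apply: ns_eq0 => phi x _.
apply: finite_torsion_singular => [u|n n0].
  have [n [n0 un]] := tG (val u); exists n; split=> //.
  by apply: val_inj; rewrite raddfMn un raddf0.
apply: sub_finite_set (finite_preimage (in2W val_inj) (fin n n0)).
move=> u un; rewrite /preimage /= -(raddfMn (val : subgroup_type H -> G)).
by rewrite un raddf0.
Qed.
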